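(* Let $(a_1,\dots,a_n)$ and $(b_1,\dots,b_k)$ be non-increasing sequences of positive integers with $(a_1,\dots,a_n)\succ(b_1,\dots,b_k)$. (i) If $a_1!a_2!\cdots a_n! + a_1a_2\cdots a_n = b_1!b_2!\cdots b_k! + b_1b_2\cdots b_k$, then $n=k$ and $a_i=b_i$ for all $i$. (ii) If $a_1!a_2!\cdots a_n! - a_1a_2\cdots a_n = b_1!b_2!\cdots b_k! - b_1b_2\cdots b_k$, then either (a) $n=k$ and $a_i=b_i$ for all $i$, or (b) all $a_i$ and all $b_i$ lie in $\{1,2\}$.
   Context: Majorization: for finite non-increasing sequences of positive integers $(a_1,\dots,a_n)$ and $(b_1,\dots,b_k)$, write $(a_1,\dots,a_n)\succ(b_1,\dots,b_k)$ if all of the following hold: (1) $n\le k$; (2) for every $i\le n$, $a_1+\dots+a_i\ge b_1+\dots+b_i$; (3) $a_1+\dots+a_n\ge b_1+\dots+b_k$. *)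

(* Defs.v *)
From mathcomp Require Import all_boot all_order all_algebra.

Set Implicit Arguments.
Unset Strict Implicit.
Unset Printing Implicit Defensive.

Import GRing.Theory.

Definition positive_nonincreasing (s : seq nat) : Prop :=
  all (fun x => 0 < x) s /\ sorted geq s.

(* This is an asymmetric variant of majorization: the two sequences may have
   different lengths and the total of [b] may be smaller than that of [a]. *)
Definition majorizes (a b : seq nat) : Prop :=
  [/\ size a <= size b,
      forall i, i <= size a -> sumn (take i b) <= sumn (take i a)
    & sumn b <= sumn a].

Definition prod_fact (s : seq nat) : nat := \prod_(x <- s) x`!.

Definition prod_seq (s : seq nat) : nat := \prod_(x <- s) x.

(* Main.v *)
Require Import Defs.
From mathcomp Require Import all_boot all_order all_algebra.
From mathcomp Require Import zify ring.

(** Majorization forces the excess [sum (x - t)^+] of [a] over every threshold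
    [t] to be at least that of [b].  A log-convex [h] with [h 0 = 1] and
    [h 0 <= h 1] satisfies [h x = prod_t c_t ^ (x - t)^+] with all [c_t >= 1],
    so the product of [h] over [a] is at least its product over [b].
    Let [F], [P], [G] be the products of [x!], [x], [(x-1)!], so [F = P G].
    All of [x!], [(x-1)!] and [x! * x] (set to 1 at 0) are log-convex, hence
    [F], [G] and [F P] are monotone; [F] is strictly so, since [x!] is strictly
    log-convex.
    (i) From [F a > F b >= P b] and [F a * P a >= F b * P b] one gets
    [F a + P a > F b + P b].
    (ii) [F - P = F (1 - 1/G)] strictly increases unless [G a = 1], and then
    all the entries are at most 2. *)

Set Implicit Arguments.
Unset Strict Implicit.
Unset Printing Implicit Defensive.

(** * Excess over a threshold *)

Definition excess (t : nat) (s : seq nat) : nat := \sum_(x <- s) (x - t).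

Lemma excess_cons t x s : excess t (x :: s) = x - t + excess t s.
Proof. by rewrite /excess big_cons. Qed.

Lemma excess_nil t : excess t [::] = 0.
Proof. by rewrite /excess big_nil. Qed.

Lemma excessS t s : excess t s = excess t.+1 s + count (fun x => t < x) s.
Proof.
elim: s => [|x s IH]; first by rewrite !excess_nil.
by rewrite !excess_cons /= IH; case: ltnP; lia.
Qed.

Lemma excess0 s : excess 0 s = sumn s.
Proof. by elim: s => [|x s IH]; rewrite ?excess_nil // excess_cons IH subn0. Qed.

Lemma excess_eq0 t s : sumn s <= t -> excess t s = 0.
Proof.
elim: s => [|x s IH] /=; first by rewrite excess_nil.
by move=> le_t; rewrite excess_cons IH; lia.
Qed.

Lemma sumn_le_excess t s : sumn s <= excess t s + size s * t.
Proof.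
elim: s => [|x s IH]; first by rewrite excess_nil.
by rewrite excess_cons /= mulSn; lia.
Qed.

Lemma excess_take m t s : excess t (take m s) <= excess t s.
Proof.
elim: s m => [|x s IH] [|m] //=; first by rewrite excess_nil.
by rewrite !excess_cons leq_add2l.
Qed.

(** The entries above [t] form a prefix of a non-increasing sequence; [m] is its length. *)
Lemma excess_sorted t s : sorted geq s ->
  exists m, sumn (take m s) = excess t s + m * t.
Proof.
elim: s => [|x s IH] /= sorted_xs; first by exists 0; rewrite excess_nil.
have [lt_tx | le_xt] := ltnP t x.
  have [m Em] := IH (path_sorted sorted_xs).
  by exists m.+1; rewrite /= Em excess_cons; lia.
exists 0; rewrite /= /excess big_seq big1 // => y.
rewrite inE => /predU1P[-> | s_y]; first by lia.
have geq_trans : transitive geq by move=> u v w; rewrite /geq /=; lia.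
have /allP/(_ y s_y) := order_path_min geq_trans sorted_xs.
by rewrite /geq /=; lia.
Qed.

(** Some prefix of [b] attains [excess t b], while every prefix of [a] bounds [excess t a] from
    below, so it is enough to compare prefix sums. *)
Lemma majorizes_excess a b t :
  sorted geq b -> majorizes a b -> excess t b <= excess t a.
Proof.
move=> sorted_b [_ le_take le_sum].
have [m Em] := excess_sorted t sorted_b.
have [le_m | lt_m] := leqP m (size a).
  have := sumn_le_excess t (take m a); rewrite size_takel //.
  by have := excess_take m t a; have := le_take m le_m; lia.
(* When [m] exceeds [size a], the whole of [a] is used and the totals are compared. *)
have := sumn_le_excess t a.
have : sumn (take m b) <= sumn b.
  by rewrite -{2}(cat_take_drop m b) sumn_cat leq_addr.
have : size a * t <= m * t by rewrite leq_mul2r ltnW ?orbT.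
by lia.
Qed.

(** Differences of the excess in [t] count the entries above [t]; differences of these counts are
    multiplicities, which determine a sorted sequence. *)
Lemma excess_inj a b :
    positive_nonincreasing a -> positive_nonincreasing b ->
  size a <= size b -> sumn b <= sumn a ->
  (forall t, excess t.+1 a = excess t.+1 b) -> a = b.
Proof.
move=> [pos_a sorted_a] [pos_b sorted_b] le_size le_sum eq_ex.
have count_pos s : all (fun x => 0 < x) s -> count (fun x => 0 < x) s = size s.
  by rewrite all_count => /eqP.
have eq_gt t : count (fun x => t < x) a = count (fun x => t < x) b.
  case: t => [|t]; last first.
    by have := excessS t.+1 a; have := excessS t.+1 b; rewrite !eq_ex; lia.
  have := excessS 0 a; have := excessS 0 b.
  by rewrite !excess0 eq_ex !count_pos //; lia.
have countS t s : count (fun x => t < x) s =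
    count_mem t.+1 s + count (fun x => t.+1 < x) s.
  by elim: s => //= x s ->; case: (ltngtP t.+1 x) => _ /=; lia.
apply: (@sorted_eq _ geq) => //.
- by move=> u v w; rewrite /geq /=; lia.
- by move=> u v; rewrite /geq /=; lia.
apply/allP => -[|t] _ /=.
  have nz s : all (fun x => 0 < x) s -> count_mem 0 s = 0.
    by move=> /allP pos_s; apply/count_memPn/negP => /pos_s.
  by rewrite !nz.
by rewrite -(eqn_add2r (count (fun x => t.+1 < x) a)) {2}eq_gt -!countS eq_gt.
Qed.

(** * Products of a log-convex function *)

Section LogConvex.

Import Order.TTheory GRing.Theory Num.Theory.
Local Open Scope ring_scope.

Variable h : nat -> nat.
Hypotheses (h_gt0 : forall x, (0 < h x)%N) (h0 : h 0 = 1%N).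
Hypothesis h_convex : forall x, (h x.+1 ^ 2 <= h x * h x.+2)%N.

Let H x : rat := (h x)%:R.

Let H_gt0 x : 0 < H x. Proof. by rewrite ltr0n. Qed.

Let H_neq0 x : H x != 0. Proof. by rewrite gt_eqF. Qed.

(* [ln (bend t)] is the second difference of [ln h], with [ln h (-1) = 0]. *)
Let bend t : rat :=
  if t is t'.+1 then H t' * H t'.+2 / H t'.+1 ^+ 2 else H 1.

Let bend_ge1 t : 1 <= bend t.
Proof.
case: t => [|t] /=; first by rewrite ler1n h_gt0.
by rewrite ler_pdivlMr ?exprn_gt0 // mul1r -natrX -natrM ler_nat.
Qed.

Let bend_gt1 t : (h t.+1 ^ 2 < h t * h t.+2)%N -> 1 < bend t.+1.
Proof.
by move=> lt_h; rewrite /= ltr_pdivlMr ?exprn_gt0 // mul1r -natrX -natrM ltr_nat.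
Qed.

Let prod_bend x : \prod_(t < x.+1) bend t = H x.+1 / H x.
Proof.
elim: x => [|x IH]; first by rewrite big_ord_recr big_ord0 /= {3}/H h0 mul1r divr1.
rewrite big_ord_recr {}IH /=; field.
by rewrite !H_neq0.
Qed.

(** Going from [x] to [x.+1] multiplies by [H x.+1 / H x], the product of [bend t] over [t <= x].
    Factors with [x <= t] are 1, so one [N] can serve all entries. *)
Let prod_bend_exp N x : (x <= N)%N -> H x = \prod_(t < N) bend t ^+ (x - t).
Proof.
elim: x => [|x IH] le_N; first by rewrite /H h0 big1 // => t _; rewrite sub0n.
transitivity (H x * \prod_(t < x.+1) bend t).
  by rewrite prod_bend; field; rewrite H_neq0.
rewrite (IH (ltnW le_N)) (big_ord_widen _ bend le_N) [X in _ * X]big_mkcond -big_split.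
apply: eq_bigr => t _ /=; case: ifP => lt_t.
  by rewrite -exprSr subSn.
by rewrite mulr1; congr (_ ^+ _); lia.
Qed.

Let prod_excess N s : (sumn s <= N)%N ->
  (\prod_(x <- s) h x)%:R = \prod_(t < N) bend t ^+ excess t s.
Proof.
elim: s => [|x s IH] /= le_N.
  by rewrite big_nil big1 // => t _; rewrite excess_nil.
have [le_x le_s] : (x <= N /\ sumn s <= N)%N by lia.
rewrite big_cons natrM (IH le_s) -/(H x) (prod_bend_exp le_x) -big_split.
by apply: eq_bigr => t _; rewrite excess_cons exprD.
Qed.

Lemma logconvex_prod_le a b : (forall t, excess t b <= excess t a)%N ->
  (\prod_(x <- b) h x <= \prod_(x <- a) h x)%N.
Proof.
move=> le_ex; rewrite -(ler_nat rat).
rewrite !(@prod_excess (sumn a + sumn b)) ?leq_addr ?leq_addl //.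
apply: ler_prod => t _.
by rewrite exprn_ge0 ?(le_trans ler01) //= ler_weXn2l.
Qed.

Lemma logconvex_prod_lt a b t : (forall t, excess t b <= excess t a)%N ->
    (h t.+1 ^ 2 < h t * h t.+2)%N -> (excess t.+1 b < excess t.+1 a)%N ->
  (\prod_(x <- b) h x < \prod_(x <- a) h x)%N.
Proof.
move=> le_ex lt_h lt_ex; rewrite -(ltr_nat rat).
(* Beyond this bound both excesses vanish, so the strict threshold indexes one of the factors. *)
have lt_t : (t.+1 < sumn a + sumn b)%N.
  rewrite ltnNge; apply: contraTN lt_ex => le_t.
  by rewrite -leqNgt excess_eq0; lia.
rewrite !(@prod_excess (sumn a + sumn b)) ?leq_addr ?leq_addl //.
rewrite (bigD1 (Ordinal lt_t)) //= [ltRHS](bigD1 (Ordinal lt_t)) //=.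
have ge1 n i : 1 <= bend i ^+ n by apply: exprn_ege1.
(* The intermediate product takes its exponent from [a] at [t.+1] and from [b] elsewhere. *)
apply: (@lt_le_trans _ _ (bend t.+1 ^+ excess t.+1 a *
    \prod_(i < sumn a + sumn b | i != Ordinal lt_t) bend i ^+ excess i b)).
  rewrite ltr_pM2r ?ltr_eXn2l ?bend_gt1 // prodr_gt0 // => i _.
  exact: lt_le_trans ltr01 (ge1 _ _).
rewrite ler_wpM2l ?(le_trans ler01 (ge1 _ _)) //.
apply: ler_prod => i _.
by rewrite exprn_ge0 ?(le_trans ler01) //= ler_weXn2l.
Qed.

End LogConvex.

(** * Products of factorials and their variants *)

Lemma fact_strict_logconvex x : x.+1`! ^ 2 < x`! * x.+2`!.
Proof. by rewrite !factS; have := fact_gt0 x; nia. Qed.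

Lemma prod_fact_predn s : all (fun x => 0 < x) s ->
  prod_fact s = prod_seq s * \prod_(x <- s) (x.-1)`!.
Proof.
move=> /allP pos_s; rewrite /prod_fact /prod_seq -big_split !big_seq /=.
by apply: eq_bigr => x /pos_s; case: x => // x _; rewrite factS.
Qed.

Section Majorized.

Variables a b : seq nat.
Hypothesis le_ex : forall t, excess t b <= excess t a.

Lemma prod_fact_lt :
    positive_nonincreasing a -> positive_nonincreasing b ->
  size a <= size b -> a <> b -> prod_fact b < prod_fact a.
Proof.
move=> ha hb le_size neq_ab.
have le_sum : sumn b <= sumn a by rewrite -!excess0.
(* Bounding [t] by [sumn a] makes the split decidable; from there on both excesses vanish. *)
have [/existsP[t lt_t] | /existsPn no_t] :=
  boolP [exists t : 'I_(sumn a), excess t.+1 b < excess t.+1 a].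
  apply: (@logconvex_prod_lt factorial _ _ _ a b t) => //.
  - exact: fact_gt0.
  - by move=> x; apply/ltnW/fact_strict_logconvex.
  exact: fact_strict_logconvex.
case: neq_ab; apply: excess_inj => // t.
have [lt_t | le_t] := ltnP t (sumn a).
  by apply/eqP; rewrite eqn_leq le_ex leqNgt (no_t (Ordinal lt_t)).
by rewrite !excess_eq0 //; lia.
Qed.

Lemma prod_fact_predn_le :
  \prod_(x <- b) (x.-1)`! <= \prod_(x <- a) (x.-1)`!.
Proof.
apply: (@logconvex_prod_le (fun x => (x.-1)`!)) => // [x|[|x]] //=.
  exact: fact_gt0.
exact/ltnW/fact_strict_logconvex.
Qed.

Lemma prod_fact_seq_le :
    all (fun x => 0 < x) a -> all (fun x => 0 < x) b ->
  prod_fact b * prod_seq b <= prod_fact a * prod_seq a.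
Proof.
move=> pos_a pos_b.
(* [maxn 1 x] agrees with [x] on positive entries and gives the value 1 at 0. *)
have E s : all (fun x => 0 < x) s ->
    prod_fact s * prod_seq s = \prod_(x <- s) (x`! * maxn 1 x).
  move=> /allP pos_s; rewrite /prod_fact /prod_seq -big_split !big_seq /=.
  by apply: eq_bigr => x /pos_s x_gt0; rewrite (maxn_idPr x_gt0).
rewrite !E //; apply: (@logconvex_prod_le (fun x => x`! * maxn 1 x)) => // x.
  by rewrite muln_gt0 fact_gt0 leq_maxl.
case: x => [|x] //.
rewrite !(maxn_idPr _) // (factS x.+2) (factS x.+1).
set f := x.+1`!.
(* Up to a common factor, the claim is [x.+2 ^ 3 <= x.+1 * x.+3 ^ 2]. *)
have -> : (x.+2 * f * x.+2) ^ 2 = f * f * x.+2 * x.+2 ^ 3 by ring.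
have -> : f * x.+1 * (x.+3 * (x.+2 * f) * x.+3) =
  f * f * x.+2 * (x.+1 * x.+3 ^ 2) by ring.
by rewrite leq_mul2l; apply/orP; right; nia.
Qed.

End Majorized.

Theorem theorem2p2 (a b : seq nat)
    (ha : positive_nonincreasing a) (hb : positive_nonincreasing b)
    (hab : majorizes a b) :
  (prod_fact a + prod_seq a = prod_fact b + prod_seq b -> a = b)
  /\
  (((prod_fact a)%:Z - (prod_seq a)%:Z = (prod_fact b)%:Z - (prod_seq b)%:Z)%R ->
     a = b
     \/ ((forall x, x \in a -> x = 1 \/ x = 2)
         /\ (forall x, x \in b -> x = 1 \/ x = 2))).
Proof.
have [pos_a _] := ha; have [pos_b sorted_b] := hb; have [le_size _ _] := hab.
have le_ex t : excess t b <= excess t a by apply: majorizes_excess.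
have [-> | /eqP neq_ab] := eqVneq a b; first by split; [|left].
have lt_F := prod_fact_lt le_ex ha hb le_size neq_ab.
have le_G := prod_fact_predn_le le_ex.
have le_FP := prod_fact_seq_le le_ex pos_a pos_b.
have G_gt0 s : 0 < \prod_(x <- s) (x.-1)`!.
  by apply: prodn_gt0 => x; apply: fact_gt0.
have P_gt0 s : all (fun x => 0 < x) s -> 0 < prod_seq s.
  by move=> /allP pos_s; rewrite /prod_seq big_seq prodn_cond_gt0.
have le12 s : all (fun x => 0 < x) s -> \prod_(x <- s) (x.-1)`! <= 1 ->
    forall x, x \in s -> x = 1 \/ x = 2.
  move=> /allP pos_s le1 x s_x; have x_gt0 := pos_s x s_x.
  have : (x.-1)`! <= 1.
    apply: leq_trans le1; rewrite (big_rem x) //=.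
    by rewrite leq_pmulr.
  by have := fact_geq x.-1; lia.
move: (G_gt0 a) (G_gt0 b) (P_gt0 a pos_a) (P_gt0 b pos_b).
move: (prod_fact_predn pos_a) (prod_fact_predn pos_b).
move: (le12 a pos_a) (le12 b pos_b).
move: le_G le_FP lt_F.
move: (prod_fact a) (prod_fact b) (prod_seq a) (prod_seq b) => Fa Fb Pa Pb.
move: (\prod_(x <- a) _) (\prod_(x <- b) _) => Ga Gb.
move=> le_G le_FP lt_F le12a le12b EFa EFb Ga_gt0 Gb_gt0 Pa_gt0 Pb_gt0.
split=> [eq_sum | eq_diff].
  have le_PF : Pb <= Fb by rewrite EFb leq_pmulr.
  have lt_P : Pa < Fb by lia.
  (* With [d = Fa - Fb = Pb - Pa], [le_FP] reduces to [Fb <= Pa], against [lt_P]. *)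
  have [d d_gt0 EFa'] : exists2 d, 0 < d & Fa = Fb + d by exists (Fa - Fb); lia.
  have EPb : Pb = Pa + d by lia.
  suff : d * Fb <= d * Pa by rewrite leq_pmul2l //; lia.
  by move: le_FP; rewrite EPb EFa' mulnDl mulnDr; lia.
right; suff le1 : Ga <= 1.
  by split; [apply: le12a | apply: le12b; apply: leq_trans le1].
rewrite leqNgt; apply/negP => Ga_gt1.
have eq_PG : Pa * (Ga - 1) = Pb * (Gb - 1) by nia.
(* [lt1] is [Fb < Fa] and [le2] is the monotonicity of [1 - 1/G], both cleared of denominators;
   [eq3] closes them into a strict cycle. *)
have lt1 : Pb * Gb * (Ga - 1) * Gb < Pa * Ga * (Ga - 1) * Gb.
  by rewrite !ltn_pmul2r ?subn_gt0 // -EFa -EFb.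
have le2 : Pb * Gb * (Ga * (Gb - 1)) <= Pb * Gb * ((Ga - 1) * Gb).
  by rewrite leq_mul2l; apply/orP; right; nia.
have eq3 : Pb * Gb * (Ga * (Gb - 1)) = Pa * Ga * (Ga - 1) * Gb.
  transitivity (Pb * (Gb - 1) * Ga * Gb); first by ring.
  by rewrite -eq_PG; ring.
by lia.
Qed.
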